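(* Let $a,b\ge 1$ be integers, $g=\gcd(a,b)$, and let $I\in\mathcal I^1_{a,b}$ with $G(I)=\{x^{i\frac ag}y^{b-i\frac bg} : i\in A\}$, where $\{0,g\}\subseteq A\subseteq[0,g]$. Then $e(F(I))=g/\gcd(A)$. In particular, $r(I)<g/\gcd(A)$.
   Context: $K$ is a field. For a monomial ideal $I\subset K[x,y]$, $G(I)$ is its unique minimal set of monomial generators. For positive integers $a,b$ and a monomial $u=x^cy^d$ put $\nu(u)=(bc+ad)/(ab)$. $\mathcal I_{a,b}$ is the set of monomial ideals $I\subset K[x,y]$ with $x^a,y^b\in G(I)$ and $\nu(u)\ge1$ for all $u\in G(I)$; $\mathcal I^1_{a,b}\subseteq\mathcal I_{a,b}$ is the subset of those $I$ with $\nu(u)=1$ for all $u\in G(I)$. For $I\in\mathcal I_{a,b}$ and $J=(x^a,y^b)$, the reduction number $r(I)$ is the smallest integer $r\ge0$ with $I^{r+1}=JI^r$ (such $r$ exists). $[c,d]$ denotes the set of integers $i$ with $c\le i\le d$, and $\gcd(A)$ is the greatest common divisor of the integers in $A$. $F(I)=\bigoplus_{k\ge0}I^k/\mathfrak m I^k$, with $\mathfrak m=(x,y)$, is the fiber cone of $I$, and for $I\in\mathcal I^1_{a,b}$ it is viewed as a standard graded $K$-algebra with $I/\mathfrak m I$ in degree $1$; $e(F(I))$ is its (Hilbert–Samuel) multiplicity. *)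

(* Defs.v *)
From HB Require Import structures.
From mathcomp Require Import all_boot all_order all_algebra.
From mathcomp Require Export mpoly.

Set Implicit Arguments.
Unset Strict Implicit.
Unset Printing Implicit Defensive.

Import Order.TTheory GRing.Theory Num.Theory.

Local Open Scope ring_scope.

(* Ideals are Prop-valued predicates, compared extensionally. *)

Section Ideals.
Variable R : comNzRingType.

Definition is_ideal (I : R -> Prop) : Prop :=
  [/\ I 0,
      forall p q, I p -> I q -> I (p + q)
    & forall r p, I p -> I (r * p)].

Definition ideal_eq (I J : R -> Prop) : Prop := forall p, I p <-> J p.

Definition ideal_gen (S : R -> Prop) (p : R) : Prop :=
  forall J, is_ideal J -> (forall s, S s -> J s) -> J p.

Definition ideal_mul (I J : R -> Prop) : R -> Prop :=
  ideal_gen (fun p => exists u v, [/\ I u, J v & p = u * v]).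

Definition ideal_exp (I : R -> Prop) (k : nat) : R -> Prop :=
  iter k (ideal_mul I) (fun=> True).

(* The minimality in r makes such an r unique: this is the graph of I |-> r(I),
   taken with respect to the reduction J. *)
Definition is_reduction_number (J I : R -> Prop) (r : nat) : Prop :=
  let red s := ideal_eq (ideal_exp I s.+1) (ideal_mul J (ideal_exp I s)) in
  red r /\ forall s, red s -> (r <= s)%N.

End Ideals.

(* dim_K (U / (U :&: W)) = d, for K-subspaces U and W of V: the classes of
   e_0, ..., e_(d-1) form a basis. *)
Definition quotient_dim (K : fieldType) (V : lmodType K) (U W : V -> Prop)
    (d : nat) : Prop :=
  exists e : 'I_d -> V,
    (forall i, U (e i)) /\
    (forall u, U u ->
       exists! c : {ffun 'I_d -> K}, W (u - \sum_(i < d) c i *: e i)).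

(* For a standard graded K-algebra F with Hilbert function H (F_k has
   K-dimension H k) and irrelevant ideal F_+, the sum below is the length of
   F / F_+^n. It agrees for n >> 0 with a polynomial Q, of degree d = dim F,
   and e(F) is d`! times the leading coefficient of Q. *)
Definition hilbert_samuel_mult (H : nat -> nat) (e : nat) : Prop :=
  exists Q : {poly rat},
    (exists N : nat, forall n : nat, (N <= n)%N ->
       Q.[n%:R] = (\sum_(k < n) H k)%:R) /\
    e%:R = ((size Q).-1)`!%:R * lead_coef Q.

Section Plane.
Variable K : fieldType.
Local Notation R := {mpoly K[2]}.

Definition varx : R := 'X_(ord0 : 'I_2).
Definition vary : R := 'X_(ord_max : 'I_2).

(* The exponent of the monomial x^c y^d. *)
Definition mon (c d : nat) : 'X_{1..2} :=
  [multinom (if i == ord0 then c else d) | i < 2].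

Definition maxideal : R -> Prop :=
  ideal_gen (fun p => p = varx \/ p = vary).

Definition monomial_gens (I : R -> Prop) (S : 'X_{1..2} -> Prop) : Prop :=
  ideal_eq I (ideal_gen (fun p => exists2 u, S u & p = 'X_[u])).

(* S is the set of exponents of G(I); this forces I to be a monomial ideal. *)
Definition min_monomial_gens (I : R -> Prop) (S : 'X_{1..2} -> Prop) : Prop :=
  monomial_gens I S /\
  forall T : 'X_{1..2} -> Prop,
    (forall u, T u -> S u) -> monomial_gens I T -> forall u, S u -> T u.

Definition nu (a b : nat) (u : 'X_{1..2}) : rat :=
  (b * u ord0 + a * u ord_max)%N%:R / (a * b)%N%:R.

Definition Iab (a b : nat) (I : R -> Prop) : Prop :=
  exists S, [/\ min_monomial_gens I S, S (mon a 0), S (mon 0 b)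
              & forall u, S u -> 1 <= nu a b u].

Definition I1ab (a b : nat) (I : R -> Prop) : Prop :=
  Iab a b I /\
  exists2 S, min_monomial_gens I S & forall u, S u -> nu a b u = 1.

Definition Jab (a b : nat) : R -> Prop :=
  ideal_gen (fun p => p = varx ^+ a \/ p = vary ^+ b).

(* H is the Hilbert function of F(I), whose component of degree k is
   I^k / m I^k. *)
Definition fiber_cone_hilbert (I : R -> Prop) (H : nat -> nat) : Prop :=
  forall k, quotient_dim (ideal_exp I k) (ideal_mul maxideal (ideal_exp I k))
                         (H k).

(* e(F(I)) = e *)
Definition fiber_cone_mult (I : R -> Prop) (e : nat) : Prop :=
  exists2 H, fiber_cone_hilbert I H & hilbert_samuel_mult H e.

End Plane.

(* Main.v *)
Require Import Defs.
From HB Require Import structures.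
From mathcomp Require Import all_boot all_order all_algebra.
From mathcomp Require Import zify ring.

Set Implicit Arguments.
Unset Strict Implicit.
Unset Printing Implicit Defensive.
Import Order.TTheory GRing.Theory Num.Theory.

(** The minimal generators of I lie on the segment joining (0, b) to (a, 0), and
    the one with parameter i in A has exponent (i a/g, b - i b/g).  Products of k
    of them lie on the k-th dilate of that segment, and depend only on the sum of
    the parameters: I^k is generated by the monomials indexed by the k-fold
    sumset kA.  Distinct monomials on one segment of negative slope do not divide
    each other, so these generators are minimal, and their classes form a basis
    of I^k / m I^k.  Hence the Hilbert function of F(I) is k |-> |kA|, and
    everything reduces to the sumsets of a set {0, g} <= A <= [0, g].  Put
    d = gcd(A) and e = g / d.

    The key fact ([sumset_reduce]) is that eA is the union of (e-1)A and
    g + (e-1)A.  Take a_1, ..., a_e in A: the e + 1 partial sums are multiples of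
    d, so they fall in only e classes modulo g, and two of them agree.  Thus some
    nonempty block of the a_i has sum q g, where q is at most the length of the
    block, and can be replaced by q copies of g and some copies of 0, without
    changing the total or the number of terms.  So the sum of the a_i can be
    written with a term equal to 0 or g.  As x^a and y^b are the generators of
    parameters g and 0, this says I^e = J I^(e-1), that is r(I) <= e - 1.

    Iterating, (r + n)A = rA + {0, g, ..., n g} for r = e - 1.  Within a class
    modulo g this is, for n large, an interval of a progression of step g, which
    gains exactly one element when n increases by one ([size_sumset_step]).  For
    k large, kA meets all e classes of multiples of d, by Bezout, so that
    |(k+1)A| = |kA| + e.  Summing, the Hilbert-Samuel polynomial is quadratic with
    leading coefficient e/2, and the multiplicity is 2! * e/2 = e. *)

(** * Sumsets of a finite set of integers *)

Fixpoint sumset (A : seq nat) (k : nat) : seq nat :=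
  if k is l.+1 then undup [seq i + x | i <- A, x <- sumset A l] else [:: 0].

Section Sumsets.

Variables (A : seq nat) (g : nat).
Hypotheses (g_gt0 : 0 < g) (A0 : 0 \in A) (Ag : g \in A).
Hypothesis A_le : {in A, forall i, i <= g}.

Local Notation d := (\big[gcdn/0]_(i <- A) i).
Local Notation e := (g %/ d).

Lemma sumset_uniq k : uniq (sumset A k).
Proof. by case: k => //= k; apply: undup_uniq. Qed.

Lemma mem_sumsetS k x :
  reflect (exists i y, [/\ i \in A, y \in sumset A k & x = i + y])
          (x \in sumset A k.+1).
Proof.
rewrite /= mem_undup; apply: (iffP allpairsP) => [[[i y] /= [? ? ->]]|].
  by exists i, y.
by case=> i [y [Ai ky ->]]; exists (i, y).
Qed.

Lemma sumset_le k x : x \in sumset A k -> x <= k * g.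
Proof.
elim: k x => [|k IHk] x; first by rewrite inE => /eqP->.
by case/mem_sumsetS=> i [y [/A_le ig /IHk yk ->]]; rewrite mulSn leq_add.
Qed.

Lemma sumsetD k l x y :
  x \in sumset A k -> y \in sumset A l -> x + y \in sumset A (k + l).
Proof.
elim: k x => [|k IHk] x; first by rewrite inE => /eqP->.
case/mem_sumsetS=> i [z [Ai kz ->]] ly; rewrite addSn -addnA.
by apply/mem_sumsetS; exists i, (z + y); split; rewrite ?IHk.
Qed.

Lemma sumset1 i : i \in A -> i \in sumset A 1.
Proof.
by move=> Ai; apply/mem_sumsetS; exists i, 0; rewrite addn0 inE eqxx.
Qed.

Lemma sumsetM n k x : x \in sumset A k -> n * x \in sumset A (n * k).
Proof.
move=> kx; elim: n => [|n IHn]; first by rewrite !mul0n inE.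
by rewrite !mulSn sumsetD.
Qed.

Lemma sumset_mulA n i : i \in A -> n * i \in sumset A n.
Proof. by move=> Ai; rewrite -[X in sumset A X]muln1 sumsetM ?sumset1. Qed.

(** Sum q copies of g and n - q copies of 0. *)
Lemma sumset_ends n q : q <= n -> q * g \in sumset A n.
Proof.
move=> /subnKC <-; rewrite -[q * g]addn0 sumsetD ?sumset_mulA //.
by rewrite -(muln0 (n - q)) sumset_mulA.
Qed.

Lemma sumset_sub k l : k <= l -> {subset sumset A k <= sumset A l}.
Proof.
move=> /subnKC <- x kx; rewrite -[x]addn0 sumsetD //.
by rewrite (@sumset_ends _ 0).
Qed.

Lemma sumset_sumn (s : seq nat) :
  {subset s <= A} -> sumn s \in sumset A (size s).
Proof.
elim: s => [|i s IHs] // sA; apply/mem_sumsetS; exists i, (sumn s).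
by split; rewrite ?sA ?mem_head // IHs // => j js; rewrite sA // inE js orbT.
Qed.

Lemma sumset_seq k x : x \in sumset A k ->
  exists s : seq nat, [/\ {subset s <= A}, size s = k & sumn s = x].
Proof.
elim: k x => [|k IHk] x; first by rewrite inE => /eqP->; exists [::].
case/mem_sumsetS=> i [y [Ai /IHk[s [sA sk sy]] ->]]; exists (i :: s).
split=> [j||] /=; rewrite ?sk ?sy //.
by rewrite inE => /predU1P[->//|/sA].
Qed.

Lemma dvd_gcd i : i \in A -> d %| i.
Proof.
elim: A => //= j s IHs; rewrite inE big_cons => /predU1P[->|/IHs si].
  exact: dvdn_gcdl.
exact: dvdn_trans (dvdn_gcdr _ _) si.
Qed.

Lemma gcd_gt0 : 0 < d.
Proof. exact: dvdn_gt0 g_gt0 (dvd_gcd Ag). Qed.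

Lemma mul_index_gcd : e * d = g.
Proof. by rewrite divnK ?dvd_gcd. Qed.

Lemma index_gt0 : 0 < e.
Proof. by rewrite divn_gt0 ?gcd_gt0 // dvdn_leq ?dvd_gcd. Qed.

Lemma dvd_sumset k x : x \in sumset A k -> d %| x.
Proof.
elim: k x => [|k IHk] x; first by rewrite inE => /eqP->; rewrite dvdn0.
by case/mem_sumsetS=> i [y [Ai /IHk ? ->]]; rewrite dvdn_add // dvd_gcd.
Qed.

(** The classes modulo g of multiples of d, the only ones that sumsets meet. *)
Definition residues : seq nat := [seq i * d | i <- iota 0 e].

Lemma size_residues : size residues = e.
Proof. by rewrite size_map size_iota. Qed.

Lemma uniq_residues : uniq residues.
Proof.
rewrite map_inj_uniq ?iota_uniq // => i j /eqP.
by rewrite eqn_pmul2r ?gcd_gt0 // => /eqP.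
Qed.

Lemma mem_residues x : d %| x -> x %% g \in residues.
Proof.
move=> dx; have dg := dvd_gcd Ag.
have dr : d %| x %% g by rewrite /dvdn modn_dvdm.
apply/mapP; exists (x %% g %/ d); last by rewrite divnK.
by rewrite mem_iota add0n /= ltn_divLR ?gcd_gt0 // mul_index_gcd ltn_mod.
Qed.

(** Pigeonhole on the e + 1 partial sums of s, which take at most e values
    modulo g: two equal ones bound the block s2. *)
Lemma zero_sum_block (s : seq nat) : {subset s <= A} -> size s = e ->
  exists s1 s2 s3, [/\ s = s1 ++ s2 ++ s3, 0 < size s2 & g %| sumn s2].
Proof.
move=> sA sz; pose P j := sumn (take j s) %% g.
have PR j : P j \in residues.
  apply: mem_residues; apply: (@dvd_sumset (size (take j s))).
  by apply: sumset_sumn => i /mem_take /sA.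
have /(uniqPn 0)[i [j []]] : ~~ uniq [seq P j | j <- iota 0 e.+1].
  apply/negP=> /(@uniq_leq_size _ _ residues).
  rewrite size_map size_iota size_residues ltnn => H.
  by have /H : {subset [seq P j | j <- iota 0 e.+1] <= residues}
    by move=> _ /mapP[j _ ->].
move=> ij; rewrite size_map size_iota => je; have ie := ltn_trans ij je.
rewrite !(nth_map 0) ?size_iota // !nth_iota // !add0n => /eqP Pij.
have Ei : take i s = take i (take j s) by rewrite take_takel // ltnW.
exists (take i s), (drop i (take j s)), (drop j s); split.
- by rewrite catA {1}Ei cat_take_drop cat_take_drop.
- by rewrite size_drop size_takel ?subn_gt0 // sz.
move: Pij; rewrite /P -[in X in _ == X](cat_take_drop i (take j s)) -Ei sumn_cat.
by rewrite -[X in X == _ %[mod _]]addn0 eqn_modDl mod0n eq_sym.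
Qed.

(** A zero-sum block of sum q g is traded for q copies of g and copies of 0; one
    of these, a 0 if q is smaller than the length of the block and a g otherwise,
    is then removed. *)
Lemma sumset_reduce x : x \in sumset A e ->
  (x \in sumset A e.-1) || (g <= x) && (x - g \in sumset A e.-1).
Proof.
case/sumset_seq=> s [sA sz <-].
have [s1 [s2 [s3 [Es s2_gt0 /dvdnP[q Eq]]]]] := zero_sum_block sA sz.
have rest : sumn s1 + sumn s3 \in sumset A (size s1 + size s3).
  by apply: sumsetD; apply: sumset_sumn => i si; apply: sA;
    rewrite Es !mem_cat si ?orbT.
have q_le : q <= size s2.
  rewrite -(leq_pmul2r g_gt0) -Eq; apply: sumset_le; apply: sumset_sumn => i si.
  by apply: sA; rewrite Es !mem_cat si orbT.
have -> : sumn s = q * g + (sumn s1 + sumn s3).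
  by rewrite Es !sumn_cat Eq addnCA.
have -> : e.-1 = (size s2).-1 + (size s1 + size s3).
  by rewrite -sz Es !size_cat; lia.
have [q_lt|] := ltnP q (size s2).
  by rewrite sumsetD // sumset_ends //; lia.
case: q {Eq} q_le => [|q] q_le; first by lia.
rewrite mulSn -addnA leq_addr addKn => s2_le.
by rewrite (sumsetD (sumset_ends _) rest) ?orbT //; lia.
Qed.

Lemma sumset_step k x : e <= k.+1 -> x \in sumset A k.+1 ->
  (x \in sumset A k) || (g <= x) && (x - g \in sumset A k).
Proof.
elim: k x => [|k IHk] x.
  rewrite leq_eqVlt => /predU1P[E|]; last by rewrite ltnS leqNgt index_gt0.
  by have := @sumset_reduce x; rewrite E.
rewrite leq_eqVlt => /predU1P[E|ek].
  by have := @sumset_reduce x; rewrite E.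
case/mem_sumsetS=> i [y [Ai /(IHk _ ek)/orP[ky|/andP[gy ky]] ->]].
  by apply/orP; left; apply/mem_sumsetS; exists i, y.
rewrite -addnBA // (leq_trans gy) ?leq_addl //=.
by apply/orP; right; apply/mem_sumsetS; exists i, (y - g).
Qed.

(** From r = e - 1 on, sumsets grow only by translation by g; [sumset_to] is the
    converse, valid for every r. *)
Lemma sumset_from r n x : e <= r.+1 -> x \in sumset A (r + n) ->
  exists y j, [/\ y \in sumset A r, j <= n & x = y + j * g].
Proof.
move=> er; elim: n x => [|n IHn] x.
  by rewrite addn0; exists x, 0; rewrite addn0.
rewrite addnS => /sumset_step; case/(_ (leq_trans er _))/orP.
- by rewrite ltnS leq_addr.
- by case/IHn=> y [j [? ? ->]]; exists y, j; split=> //; apply: leqW.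
case/andP=> gx /IHn[y [j [yr jn E]]]; exists y, j.+1; split=> //.
by rewrite -(subnK gx) E mulSn -addnA [_ + g]addnC.
Qed.

Lemma sumset_to r n y j :
  y \in sumset A r -> j <= n -> y + j * g \in sumset A (r + n).
Proof. by move=> ry jn; rewrite sumsetD ?sumset_ends. Qed.

(** The set P of integers that, up to adding multiples of g, belong to some
    sumset is closed under addition.  It is closed under gcd as well: modulo g,
    the Bezout combination u x - v y is u x + v (g - 1) y. *)
Lemma gcd_residue : exists k t, d + t * g \in sumset A k.
Proof.
pose P x := exists k t, x + t * g \in sumset A k.
have PM n x : P x -> P (n * x).
  case=> k [t kx]; exists (n * k), (n * t).
  by rewrite -mulnA -mulnDr sumsetM.
have PD x y : P x -> P y -> P (x + y).
  case=> k [t kx] [l [u ly]]; exists (k + l), (t + u).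
  by rewrite mulnDl addnACA sumsetD.
have PA i : i \in A -> P i.
  by move=> Ai; exists 1, 0; rewrite addn0 sumset1.
have P0 : P 0 by apply: PA.
have Pg x y : P x -> P y -> P (gcdn x y).
  have [->|x_gt0] := posnP x; first by rewrite gcd0n.
  move=> Px Py; have [u v E _] := egcdnP y x_gt0.
  have [k [t kz]] : P (u * x + v * (g.-1 * y)) by apply/PD/PM/PM; first exact: PM.
  exists k, (v * y + t); rewrite mulnDl addnA.
  suff <- : u * x + v * (g.-1 * y) = gcdn x y + v * y * g by [].
  rewrite E -{2}(prednK g_gt0); lia.
suff: forall s : seq nat, {subset s <= A} -> P (\big[gcdn/0]_(i <- s) i) by apply.
elim=> [|i s IHs] sA; first by rewrite big_nil.
rewrite big_cons; apply: Pg; first by apply: PA; rewrite sA ?mem_head.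
by apply: IHs => j js; rewrite sA // inE js orbT.
Qed.

(** If the class of d is met by kA, that of i d is met by (i k)A, and sumsets
    increase; so (e k)A meets them all. *)
Lemma sumset_residues : exists N, forall k, N <= k -> forall x, x \in residues ->
  exists2 y, y \in sumset A k & y = x %[mod g].
Proof.
have [k [t kt]] := gcd_residue; exists (e * k) => l ekl _ /mapP[i + ->].
rewrite mem_iota add0n => /= ie; exists (i * (d + t * g)); last first.
  by rewrite mulnDr mulnA -modnDmr modnMl addn0.
apply: sumset_sub (leq_trans _ ekl) _ (sumsetM _ kt).
by rewrite leq_mul2r (ltnW ie) orbT.
Qed.

(** Reduction modulo g is a bijection from the elements of (k+1)A outside kA onto
    the e classes of multiples of d.  Surjectivity: in each class, climb by steps
    of g from an element of kA until kA is left.  Injectivity: a new element is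
    s + (n + 1) g with s in rA; if s < s' are congruent, then s' = s + q g, so
    that s + (n + 1) g = s' + (n + 1 - q) g is already in kA. *)
Lemma size_sumset_step : exists N, forall k, N <= k ->
  size (sumset A k.+1) = size (sumset A k) + e.
Proof.
have [N HN] := sumset_residues; pose r := e.-1.
have er : e <= r.+1 by rewrite prednK ?index_gt0.
(* 2r makes n = k - r at least r, which bounds the quotient q below. *)
exists (maxn N (r + r)) => k; rewrite geq_max => /andP[Nk rk].
have [n Ek] : exists n, k = r + n by exists (k - r); lia.
set S := sumset A k; set S' := sumset A k.+1.
pose new := [seq x <- S' | x \notin S].
have -> : size S' = size S + size new.
  rewrite -(count_predC (mem S) S') size_filter; congr (_ + _).
  rewrite -size_filter; apply/perm_size/uniq_perm.
  - by rewrite filter_uniq ?sumset_uniq.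
  - exact: sumset_uniq.
  by move=> x; rewrite mem_filter andb_idr // => /(sumset_sub (leqnSn k)).
suff /perm_size : perm_eq [seq x %% g | x <- new] residues.
  by rewrite size_map size_residues => ->.
apply: uniq_perm; last 1 first.
- move=> x; apply/mapP/idP=> [[y + ->]|Rx].
    by rewrite mem_filter => /andP[_ /dvd_sumset]; apply: mem_residues.
  have xg : x %% g = x.
    case/mapP: Rx => i + ->; rewrite mem_iota add0n => /= ie.
    by rewrite modn_small // -[X in _ < X]mul_index_gcd ltn_pmul2r ?gcd_gt0.
  have [y ky Ey] := HN k Nk x Rx.
  have ex_out : exists j, y + j * g \notin S.
    exists k.+1; apply/negP=> /sumset_le.
    by rewrite mulSn; lia.
  case: (ex_minnP ex_out) => [[|j]]; rewrite ?addn0 ?ky // => out min_j.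
  have j_in : y + j * g \in S by apply: contraT => /min_j; rewrite ltnn.
  exists (y + j.+1 * g); last by rewrite -xg -Ey -modnDmr modnMl addn0.
  rewrite mem_filter out mulSn [g + _]addnC addnA /S' -(addn1 k).
  by rewrite sumsetD ?sumset1.
- rewrite map_inj_in_uniq ?filter_uniq ?sumset_uniq // => x x'.
  have top z : z \in new -> exists2 s, s \in sumset A r & z = s + n.+1 * g.
    rewrite mem_filter /S' Ek -addnS => /andP[out /(sumset_from er)].
    case=> s [j [rs]]; rewrite leq_eqVlt => /predU1P[->|jn] Ez; first by exists s.
    by case/negP: out; rewrite Ez /S Ek sumset_to.
  have ltF s s' : s \in sumset A r -> s' \in sumset A r -> s < s' ->
      s = s' %[mod g] -> s + n.+1 * g \notin new.
    move=> rs rs' ss' /esym/eqP; rewrite eqn_mod_dvd; last exact: ltnW.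
    case/dvdnP=> q Eq; have Es' : s' = s + q * g by rewrite -Eq subnKC // ltnW.
    rewrite mem_filter negb_and negbK; apply/orP; left.
    have q_gt0 : 0 < q.
      by rewrite lt0n; apply: contraTneq ss' => q0; rewrite Es' q0 addn0 ltnn.
    have q_le : q <= n.
      have : q * g <= r * g by apply: leq_trans (sumset_le rs'); rewrite Es' leq_addl.
      by rewrite leq_pmul2r //; lia.
    have -> : s + n.+1 * g = s' + (n.+1 - q) * g.
      by rewrite Es' -addnA -mulnDl subnKC // leqW.
    by rewrite /S Ek sumset_to //; lia.
  move=> new_x new_x'; have [s rs Ex] := top x new_x.
  have [s' rs' Ex'] := top x' new_x' => /eqP.
  rewrite Ex Ex' eqn_modDr => /eqP Es.
  case: (ltngtP s s') => [ss'|s's|-> //].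
    by move: new_x; rewrite Ex (negPf (ltF _ _ rs rs' ss' Es)).
  by move: new_x'; rewrite Ex' (negPf (ltF _ _ rs' rs s's (esym Es))).
exact: uniq_residues.
Qed.

End Sumsets.

Local Open Scope ring_scope.

(** * Ideals given by generators *)

Section IdealTheory.

Variable R : comNzRingType.
Implicit Types (S T I J : R -> Prop).

Lemma ideal_gen_ideal S : is_ideal (ideal_gen S).
Proof.
split=> [J [] //|p q Sp Sq J idJ SJ|r p Sp J idJ SJ].
  by have [_ JD _] := idJ; apply: JD; [apply: Sp | apply: Sq].
by have [_ _ JM] := idJ; apply: JM; apply: Sp.
Qed.

Lemma sub_ideal_gen S s : S s -> ideal_gen S s.
Proof. by move=> Ss J _ SJ; apply: SJ. Qed.

Lemma ideal_gen_sub S T :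
  (forall s, S s -> ideal_gen T s) -> forall p, ideal_gen S p -> ideal_gen T p.
Proof. by move=> ST p; apply; first exact: ideal_gen_ideal. Qed.

Lemma ideal_mul_sub I I' J J' :
  (forall p, I p -> I' p) -> (forall p, J p -> J' p) ->
  forall p, ideal_mul I J p -> ideal_mul I' J' p.
Proof.
move=> sI sJ; apply: ideal_gen_sub => _ [u [v [Iu Jv ->]]].
by apply: sub_ideal_gen; exists u, v; split; auto.
Qed.

Lemma ideal_mul_eq I I' J J' :
  ideal_eq I I' -> ideal_eq J J' -> ideal_eq (ideal_mul I J) (ideal_mul I' J').
Proof.
by move=> EI EJ p; split; apply: ideal_mul_sub => q; rewrite ?EI ?EJ // -?EI -?EJ.
Qed.

Lemma ideal_mul_gen S T :
  ideal_eq (ideal_mul (ideal_gen S) (ideal_gen T))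
           (ideal_gen (fun p => exists s t, [/\ S s, T t & p = s * t])).
Proof.
pose P := ideal_gen (fun p => exists s t, [/\ S s, T t & p = s * t]).
have [P0 PD PM] : is_ideal P := ideal_gen_ideal _.
move=> p; split; apply: ideal_gen_sub => _ [u [v [Su Tv ->]]]; last first.
  by apply: sub_ideal_gen; exists u, v; split=> //; apply: sub_ideal_gen.
have gen_l s : S s -> P (s * v).
  move=> Ss; apply: (Tv (fun q => P (s * q))) => [|t Tt].
    split=> [|q r|r q]; rewrite ?mulr0 ?mulrDr ?(mulrCA s) //; first exact: PD.
    exact: PM.
  by apply: sub_ideal_gen; exists s, t.
apply: (Su (fun q => P (q * v))) => //.
split=> [|q r|r q]; rewrite ?mul0r ?mulrDl -?mulrA //; first exact: PD.
exact: PM.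
Qed.

End IdealTheory.

(** * Monomial ideals *)

Section MonomialIdeals.

Variables (n : nat) (K : fieldType).
Local Notation R := {mpoly K[n]}.
Implicit Types (L M : seq 'X_{1..n}) (p q : R).

Definition monideal L : R -> Prop :=
  ideal_gen (fun p => exists2 u, u \in L & p = 'X_[u]).

Definition above L (m : 'X_{1..n}) := has (fun u => (u <= m)%MM) L.

(** Monomial ideals are graded by exponents: membership is tested on the support. *)
Lemma monidealP L p : monideal L p <-> {in msupp p, forall m, above L m}.
Proof.
split=> [Lp m pm|Lp].
  pose J q := {in msupp q, forall m, above L m}; apply: (Lp J) pm => [|_ [u Lu ->] k].
    split=> [k|q r Jq Jr k /msuppD_le|r q Jq k /msuppM_le/allpairsP[[k1 k2] /= []]].
    - by rewrite msupp0.
    - by rewrite mem_cat => /orP[/Jq|/Jr].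
    move=> _ /Jq/hasP[u Lu le_u] ->; apply/hasP; exists u => //.
    exact: lepm_trans le_u (lem_addl _ _).
  by rewrite msuppX inE => /eqP->; apply/hasP; exists u; rewrite ?lepm_refl.
have [G0 GD GM] : is_ideal (monideal L) := ideal_gen_ideal _.
rewrite (mpolyE p) big_seq; apply: (big_ind (monideal L)) => // m /Lp /hasP[u Lu um].
rewrite -(submK um) mpolyXD -mul_mpolyC mulrA; apply: GM.
by apply: sub_ideal_gen; exists u.
Qed.

Lemma monideal_sub L M :
  (forall p, monideal L p -> monideal M p) <-> all (above M) L.
Proof.
split=> [LM|/allP LM].
  apply/allP=> u Lu; have /LM/monidealP : monideal L 'X_[u].
    by apply: sub_ideal_gen; exists u.
  by apply; rewrite msuppX inE.
apply: ideal_gen_sub => _ [u /LM Mu ->]; apply/monidealP => m.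
by rewrite msuppX inE => /eqP->.
Qed.

Lemma eq_monideal L M : L =i M -> ideal_eq (monideal L) (monideal M).
Proof.
by move=> LM p; split; apply: ideal_gen_sub => _ [u Lu ->];
  apply: sub_ideal_gen; exists u; rewrite // ?LM // -LM.
Qed.

(** This makes equality of finitely generated monomial ideals decidable. *)
Lemma monideal_eqP L M :
  ideal_eq (monideal L) (monideal M) <-> all (above M) L && all (above L) M.
Proof.
split=> [E|/andP[/monideal_sub LM /monideal_sub ML] p]; last by split; auto.
by apply/andP; split; apply/monideal_sub => p /E.
Qed.

Definition mulm_seq L M := [seq (u + v)%MM | u <- L, v <- M].

Lemma monideal_mul L M :
  ideal_eq (ideal_mul (monideal L) (monideal M)) (monideal (mulm_seq L M)).
Proof.
move=> p; rewrite (ideal_mul_gen _ _ p); split; apply: ideal_gen_sub.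
  move=> _ [_ [_ [[u Lu ->] [v Mv ->] ->]]]; apply: sub_ideal_gen.
  by exists (u + v)%MM; rewrite ?mpolyXD // allpairs_f.
move=> _ [_ /allpairsP[[u v] /= [Lu Mv ->]] ->]; apply: sub_ideal_gen.
by exists 'X_[u], 'X_[v]; split; rewrite ?mpolyXD //; [exists u | exists v].
Qed.

Definition variables : seq 'X_{1..n} := [seq U_(i)%MM | i : 'I_n].

(** The monomials of the product with the maximal ideal are the proper multiples
    of generators, none of which is a generator as L is an antichain.  So the
    coordinates of the class of p are the coefficients of p at the generators. *)
Lemma quotient_dim_monideal L : uniq L ->
  {in L &, forall u v, (u <= v)%MM -> u = v} ->
  quotient_dim (monideal L) (ideal_mul (monideal variables) (monideal L)) (size L).
Proof.
move=> uL antiL; pose t := in_tuple L.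
have tL i : tnth t i \in L by apply: mem_tnth.
have t_inj : injective (tnth t) by apply/tuple_uniqP.
exists (fun i => 'X_[tnth t i]); split=> [i|p /monidealP Lp].
  by apply: sub_ideal_gen; exists (tnth t i).
have coef (c : {ffun 'I_(size L) -> K}) m :
    (p - \sum_(i < size L) c i *: 'X_[tnth t i])@_m
    = p@_m - \sum_(i < size L) c i * (tnth t i == m)%:R.
  rewrite mcoeffB raddf_sum /=; congr (_ - _).
  by apply: eq_bigr => i _; rewrite mcoeffZ mcoeffX.
have coef_gen (c : {ffun 'I_(size L) -> K}) i :
    (p - \sum_(i < size L) c i *: 'X_[tnth t i])@_(tnth t i) = p@_(tnth t i) - c i.
  rewrite coef (bigD1 i) //= eqxx mulr1 big1 ?addr0 // => j ji.
  by rewrite (inj_eq t_inj) (negPf ji) mulr0.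
exists [ffun i => p@_(tnth t i)]; split=> [|c].
  apply/monideal_mul/monidealP => m; rewrite mcoeff_msupp.
  have [/(tnthP t)[i ->]|mL] := boolP (m \in L).
    by rewrite coef_gen ffunE subrr eqxx.
  rewrite coef big1 ?subr0 => [|i _]; last first.
    by rewrite (negPf (contraNneq _ mL)) ?mulr0 // => <-.
  rewrite -mcoeff_msupp => /Lp /hasP[u Lu um].
  have [j uj] : exists j, (u j < m j)%N.
    apply/existsP; apply: contraR mL; rewrite negb_exists => /forallP le_mu.
    suff <- : u = m by [].
    by apply/mnmP => j; apply/eqP; rewrite eqn_leq (mnm_lepP um) leqNgt le_mu.
  apply/hasP; exists (U_(j) + u)%MM; first by rewrite allpairs_f // map_f ?mem_enum.
  apply/mnm_lepP => i; rewrite mnmDE mnm1E.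
  by case: eqP => [<-|_] //=; apply/mnm_lepP.
move=> /monideal_mul/monidealP Wc; apply/ffunP => i; rewrite ffunE.
apply/eqP; rewrite -subr_eq0 -coef_gen; apply: contraT.
rewrite -mcoeff_msupp => /Wc /hasP[_ /allpairsP[[_ u] /= [/mapP[j _ ->] Lu ->]] le_u].
have Eu : u = tnth t i.
  by apply: antiL => //; apply: lepm_trans le_u; apply: lem_addl.
by move/mnm_lepP/(_ j): le_u; rewrite Eu mnmDE mnm1E eqxx add1n ltnn.
Qed.

End MonomialIdeals.

(** * Multiplicity from an eventually affine Hilbert function *)

Section HilbertPolynomial.

Lemma hilbert_samuel_mult_affine (H : nat -> nat) e N : (0 < e)%N ->
  (forall k, (N <= k)%N -> H k.+1 = H k + e)%N -> hilbert_samuel_mult H e.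
Proof.
move=> e_gt0 HS; pose h : rat := (H N)%:R; pose E : rat := e%:R; pose M : rat := N%:R.
have E2 : E / 2 != 0 by rewrite mulf_neq0 ?pnatr_eq0 ?invr_eq0 // -lt0n.
(* The coefficients come from expanding, in powers of n,
   (sum of H over [0, N[) + h (n - N) + E (n - N) (n - N - 1) / 2. *)
pose beta := h - E * M - E / 2.
pose gamma := (\sum_(k < N) H k)%:R - h * M + E / 2 * (M ^+ 2 + M).
exists (Poly [:: gamma; beta; E / 2]); split; last first.
  by rewrite lead_coefE (PolyK (c := 0)) //= factS mulrCA divff ?mulr1 ?pnatr_eq0.
have Hlin k : (H (N + k)%N)%:R = h + k%:R * E :> rat.
  elim: k => [|k IHk]; first by rewrite addn0 mul0r addr0.
  rewrite addnS HS ?leq_addr // natrD IHk -[k.+1]addn1 natrD; ring.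
exists N => n /subnKC <-; rewrite horner_Poly /=.
elim: (n - N)%N => [|k IHk]; first by rewrite addn0 /gamma /beta; field.
rewrite addnS big_ord_recr /= natrD -IHk Hlin /gamma /beta -addnS !natrD -addn1 natrD.
by rewrite -/M; field.
Qed.

End HilbertPolynomial.

(** * Powers of the ideal and sumsets *)

Section FiberCone.

Variables (K : fieldType) (a b : nat) (A : seq nat).
Local Notation g := (gcdn a b).
Local Notation R := {mpoly K[2]}.
Hypotheses (a_gt0 : (0 < a)%N) (b_gt0 : (0 < b)%N).
Hypotheses (A0 : 0%N \in A) (Ag : g \in A).
Hypothesis A_le : {in A, forall i, i <= g}%N.

Lemma mon_ord0 c d : mon c d ord0 = c. Proof. by rewrite mnmE. Qed.

Lemma mon_ord_max c d : mon c d ord_max = d. Proof. by rewrite mnmE. Qed.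

Lemma monD c d c' d' : (mon c d + mon c' d')%MM = mon (c + c') (d + d').
Proof. by apply/mnmP => i; rewrite mnmDE !mnmE; case: ifP. Qed.

Let g_gt0 : (0 < g)%N. Proof. by rewrite gcdn_gt0 a_gt0. Qed.

Let aE : (g * (a %/ g) = a)%N. Proof. by rewrite mulnC divnK ?dvdn_gcdl. Qed.

Let bE : (g * (b %/ g) = b)%N. Proof. by rewrite mulnC divnK ?dvdn_gcdr. Qed.

(** The lattice point of parameter i on the k-th dilate of the segment joining
    (0, b) to (a, 0); the subtraction does not truncate when i <= k g, by
    [line_height]. *)
Definition line_mon k i : 'X_{1..2} := mon (i * (a %/ g)) (k * b - i * (b %/ g)).

Lemma line_height k i : (i <= k * g)%N -> (i * (b %/ g) <= k * b)%N.
Proof. by move=> ik; rewrite -[X in (_ <= k * X)%N]bE mulnA leq_mul2r ik orbT. Qed.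

Lemma line_monD k l i j : (i <= k * g)%N -> (j <= l * g)%N ->
  (line_mon k i + line_mon l j)%MM = line_mon (k + l) (i + j).
Proof.
move=> /line_height ik /line_height jl.
by rewrite /line_mon monD -mulnDl !mulnDl; congr (mon _ _); lia.
Qed.

Lemma line_mon0 : line_mon 1 0 = mon 0 b.
Proof. by rewrite /line_mon !mul0n mul1n subn0. Qed.

Lemma line_mong : line_mon 1 g = mon a 0.
Proof. by rewrite /line_mon aE bE mul1n subnn. Qed.

(** Along the segment the first coordinate increases and the second decreases. *)
Lemma line_mon_anti k i j : (i <= k * g)%N -> (j <= k * g)%N ->
  (line_mon k i <= line_mon k j)%MM -> i = j.
Proof.
move=> /line_height ik /line_height jk /mnm_lepP le_ij.
move: (le_ij ord0) (le_ij ord_max); rewrite !mon_ord0 !mon_ord_max.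
have a'_gt0 : (0 < a %/ g)%N by rewrite divn_gt0 // dvdn_leq ?dvdn_gcdl.
have b'_gt0 : (0 < b %/ g)%N by rewrite divn_gt0 // dvdn_leq ?dvdn_gcdr.
rewrite leq_pmul2r // => ij le_b; apply/eqP; rewrite eqn_leq ij /=.
rewrite -(leq_pmul2r b'_gt0); lia.
Qed.

Definition power_gens k := [seq line_mon k i | i <- sumset A k].

Lemma power_gens_inj k : {in sumset A k &, injective (line_mon k)}.
Proof.
move=> i j /(sumset_le A_le) ik /(sumset_le A_le) jk E.
by apply: (line_mon_anti ik jk); rewrite E lepm_refl.
Qed.

Lemma mulm_power_gens k : mulm_seq (power_gens 1) (power_gens k) =i power_gens k.+1.
Proof.
move=> m; apply/allpairsP/mapP.
  case=> [[_ _] /= [/mapP[i Si ->] /mapP[j Sj ->] ->]]; exists (i + j)%N.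
    exact: (@sumsetD A 1).
  by rewrite line_monD ?(sumset_le A_le).
case=> _ /mem_sumsetS[i [j [/sumset1 Si Sj ->]]] ->.
exists (line_mon 1 i, line_mon k j); split; rewrite /= ?map_f //.
by rewrite line_monD ?(sumset_le A_le).
Qed.

Lemma maxideal_monideal : ideal_eq (@maxideal K) (monideal (variables 2)).
Proof.
move=> p; split; apply: ideal_gen_sub => q.
  by case=> ->; apply: sub_ideal_gen; [exists U_(ord0)%MM | exists U_(ord_max)%MM];
    rewrite // map_f ?mem_enum.
case=> _ /mapP[i _ ->] ->; apply: sub_ideal_gen.
have [->|->] : i = ord0 \/ i = ord_max; [|by left|by right].
by case: i => [[|[|//]] ?]; [left | right]; apply: val_inj.
Qed.

Lemma Jab_monideal : ideal_eq (@Jab K a b) (monideal [:: mon a 0; mon 0 b]).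
Proof.
have Ea : varx K ^+ a = 'X_[mon a 0].
  rewrite /varx mpolyXn; congr 'X_[_]; apply/mnmP => i.
  by rewrite mulmnE mnm1E mnmE eq_sym; case: eqP => _; rewrite ?mul1n ?mul0n.
have Eb : vary K ^+ b = 'X_[mon 0 b].
  rewrite /vary mpolyXn; congr 'X_[_]; apply/mnmP => i.
  rewrite mulmnE mnm1E mnmE.
  by case: i => [[|[|//]] ?]; rewrite -!val_eqE /= ?mul1n ?mul0n.
move=> p; split; apply: ideal_gen_sub => q.
  by case=> ->; apply: sub_ideal_gen; [exists (mon a 0) | exists (mon 0 b)];
    rewrite // !inE eqxx ?orbT.
by case=> u; rewrite !inE => /orP[]/eqP-> ->; apply: sub_ideal_gen; [left | right].
Qed.

Variable I : R -> Prop.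
Hypothesis I_gens : ideal_eq I (monideal (power_gens 1)).

Local Notation e := (g %/ \big[gcdn/0]_(i <- A) i)%N.

Lemma ideal_exp_monideal k : ideal_eq (ideal_exp I k) (monideal (power_gens k)).
Proof.
elim: k => [|k IHk] p.
  split=> // _; apply/monidealP => m _.
  rewrite /above /= /line_mon !mul0n orbF; apply/mnm_lepP => i.
  by rewrite mnmE if_same.
rewrite [ideal_exp _ _]/= (ideal_mul_eq I_gens IHk) (monideal_mul _ _).
exact: eq_monideal (mulm_power_gens k) p.
Qed.

Lemma fiber_cone_hilbert_sumset : fiber_cone_hilbert I (fun k => size (sumset A k)).
Proof.
move=> k; have Ek := ideal_exp_monideal k.
have [] := @quotient_dim_monideal 2 K (power_gens k).
- by rewrite map_inj_in_uniq ?sumset_uniq //; apply: power_gens_inj.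
- move=> _ _ /mapP[i Si ->] /mapP[j Sj ->] le_ij; congr line_mon.
  by apply: line_mon_anti le_ij; exact: (sumset_le A_le).
rewrite size_map => f [fU fB]; exists f; split=> [i|u /Ek /fB]; first exact/Ek.
have EW := ideal_mul_eq maxideal_monideal Ek.
case=> c [Wc uc]; exists c; split=> [|c']; first exact/EW.
by move/EW/uc.
Qed.

(** Both sides of I^(s+1) = J I^s are monomial ideals with explicit finite lists
    of generators, so that the equality can be decided. *)
Lemma reduction_test s :
  ideal_eq (ideal_exp I s.+1) (ideal_mul (Jab a b) (ideal_exp I s)) <->
  ideal_eq (@monideal 2 K (power_gens s.+1))
           (monideal (mulm_seq [:: mon a 0; mon 0 b] (power_gens s))).
Proof.
have EJ := ideal_mul_eq Jab_monideal (ideal_exp_monideal s).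
by split=> E p; move: (E p) (ideal_exp_monideal s.+1 p) (EJ p)
  (@monideal_mul 2 K [:: mon a 0; mon 0 b] (power_gens s) p); tauto.
Qed.

(** The translate of [sumset_reduce]: multiplying by y^b keeps the parameter of a
    generator, multiplying by x^a adds g to it. *)
Lemma reduction_at_index :
  ideal_eq (ideal_exp I e) (ideal_mul (Jab a b) (ideal_exp I e.-1)).
Proof.
have e_gt0 : (0 < e)%N := index_gt0 g_gt0 Ag.
rewrite -{1}(prednK e_gt0); apply/reduction_test/eq_monideal => m.
rewrite -line_mon0 -line_mong; apply/mapP/allpairsP.
  case=> x Sx ->; have := sumset_reduce g_gt0 A0 Ag A_le.
  rewrite -{1}(prednK e_gt0) => /(_ x Sx) /orP[Sx'|/andP[gx Sx']];
    have x_le := sumset_le A_le Sx'.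
    exists (line_mon 1 0, line_mon e.-1 x); split; rewrite /= ?map_f ?inE ?eqxx ?orbT //.
    by rewrite line_monD.
  exists (line_mon 1 g, line_mon e.-1 (x - g)); split; rewrite /= ?map_f ?inE ?eqxx //.
  by rewrite line_monD ?mul1n // subnKC.
case=> [[u _] /= [+ /mapP[j Sj ->] ->]]; have j_le := sumset_le A_le Sj.
rewrite !inE => /orP[]/eqP->.
  exists (g + j)%N; last by rewrite line_monD ?mul1n.
  by apply: (@sumsetD A 1); rewrite ?sumset1.
exists (0 + j)%N; last by rewrite line_monD.
by apply: (@sumsetD A 1); rewrite ?sumset1.
Qed.

Lemma fiber_cone_mult_index : fiber_cone_mult I e.
Proof.
exists (fun k => size (sumset A k)); first exact: fiber_cone_hilbert_sumset.
have [N HN] := size_sumset_step g_gt0 A0 Ag A_le.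
exact: hilbert_samuel_mult_affine (index_gt0 g_gt0 Ag) HN.
Qed.

(** The equality holds for e - 1 and is decidable in s, so that a least s exists. *)
Lemma reduction_number_lt : exists2 r, is_reduction_number (Jab a b) I r & (r < e)%N.
Proof.
pose Jgens s := mulm_seq [:: mon a 0; mon 0 b] (power_gens s).
pose test s := all (above (Jgens s)) (power_gens s.+1)
  && all (above (power_gens s.+1)) (Jgens s).
have testP s :
    ideal_eq (ideal_exp I s.+1) (ideal_mul (Jab a b) (ideal_exp I s)) <-> test s.
  by apply: (iff_trans (reduction_test s)); apply: monideal_eqP.
have e_gt0 : (0 < e)%N := index_gt0 g_gt0 Ag.
have te : test e.-1 by apply/testP; rewrite prednK //; apply: reduction_at_index.
case: (ex_minnP (ex_intro test _ te)) => r /testP tr min_r; exists r.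
  by split=> // s /testP; apply: min_r.
by rewrite -(prednK e_gt0) ltnS min_r.
Qed.

End FiberCone.

Theorem theorem2p1 (K : fieldType) (a b : nat) (ha : (1 <= a)%N) (hb : (1 <= b)%N)
    (A : {set 'I_(gcdn a b).+1}) (hA0 : ord0 \in A) (hAg : ord_max \in A)
    (I : {mpoly K[2]} -> Prop) (hI : I1ab a b I)
    (hG : min_monomial_gens I (fun u => exists2 i : 'I_(gcdn a b).+1, i \in A &
            u = mon (i * (a %/ gcdn a b)) (b - i * (b %/ gcdn a b)))) :
  let e := (gcdn a b %/ \big[gcdn/0]_(i in A) (i : nat))%N in
  fiber_cone_mult I e /\
  exists2 r : nat, is_reduction_number (Jab a b) I r & (r < e)%N.
Proof.
move=> e; pose As := [seq val i | i <- enum A].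
have As0 : 0%N \in As by apply/mapP; exists ord0; rewrite ?mem_enum.
have Asg : gcdn a b \in As by apply/mapP; exists ord_max; rewrite ?mem_enum.
have As_le : {in As, forall i, i <= gcdn a b}%N.
  by move=> _ /mapP[i _ ->]; rewrite -ltnS ltn_ord.
have -> : e = (gcdn a b %/ \big[gcdn/0]_(i <- As) i)%N.
  by rewrite /e big_map big_enum.
have I_gens : ideal_eq I (monideal (power_gens a b As 1)).
  have [EI _] := hG; move=> p; rewrite EI; split; apply: ideal_gen_sub => _ [u Su ->];
    apply: sub_ideal_gen; exists u => //; move: Su.
    case=> i Ai ->; apply/mapP; exists (val i); last by rewrite /line_mon mul1n.
    by apply: sumset1; apply: map_f; rewrite mem_enum.
  case/mapP=> _ /mem_sumsetS[_ [_ [/mapP[i + ->] /[!inE]/eqP-> ->]]] ->.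
  by rewrite mem_enum => Ai; exists i; rewrite // /line_mon mul1n addn0.
split; first exact: fiber_cone_mult_index.
exact: reduction_number_lt.
Qed.
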